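(* Let $S$ and $T$ be finite semigroups. Then the (semigroup) free product $S\star T$ is an automaton semigroup.
   Context: An automaton is a triple $\mathcal{A}=(Q,B,\delta)$ where $Q$ is a finite set of states, $B$ is a finite alphabet of symbols, and $\delta$ is a transformation of $Q\times B$ (a map $Q\times B\to Q\times B$). Each state $q\in Q$ acts on the right on the set $B^*$ of finite words over $B$: for $\alpha=\alpha_1\alpha_2\cdots\alpha_n\in B^*$, $\alpha\cdot q=\beta_1\beta_2\cdots\beta_n$ where $q_0=q$ and $(q_{i-1},\alpha_i)\delta=(q_i,\beta_i)$ for $i=1,\dots,n$. A non-empty word $w=w_1\cdots w_m\in Q^+$ acts by $\alpha\cdot w=(\cdots((\alpha\cdot w_1)\cdot w_2)\cdots)\cdot w_m$. Regarding $B^*$ as a rooted tree (the children of $\alpha$ are the words $\alpha b$, $b\in B$), this gives a homomorphism $\phi:Q^+\to\operatorname{End}B^*$ to the endomorphism semigroup of the tree (maps written on the right); its image is denoted $\Sigma(\mathcal{A})$. A semigroup $S$ is an automaton semigroup if there is an automaton $\mathcal{A}$ with $S\simeq\Sigma(\mathcal{A})$. The free product $S\star T$ of semigroups $S=\langle X_1\mid R_1\rangle$ and $T=\langle X_2\mid R_2\rangle$ (semigroup presentations with $X_1,X_2$ disjoint) is the semigroup with presentation $\langle X_1\cup X_2\mid R_1\cup R_2\rangle$, i.e. the coproduct in the category of semigroups. *)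

(* Defs.v *)
From HB Require Import structures.
From mathcomp Require Import all_boot generic_quotient boolp.

Set Implicit Arguments.
Unset Strict Implicit.
Unset Printing Implicit Defensive.

Import Algebra.

Local Open Scope quotient_scope.
Local Open Scope group_scope.

#[short(type="finSemigroupType")]
HB.structure Definition FinSemigroup := {S of Semigroup S & Finite S}.

Definition isomorphic (S T : semigroupType) : Prop :=
  exists f : {multiplicative S -> T}, bijective f.

(* The free semigroup X^+: a non-empty word is its first letter together with
   the sequence of the remaining ones. *)
Record word (X : Type) := Word { first : X; rest : seq X }.

Definition letters X (w : word X) : seq X := first w :: rest w.

Definition letter X (x : X) : word X := Word x [::].

Definition word_cat X (u v : word X) : word X :=
  Word (first u) (rest u ++ letters v).

Definition map_word X Y (f : X -> Y) (w : word X) : word Y :=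
  Word (f (first w)) (map f (rest w)).

Fact word_pairK X :
  cancel (fun w : word X => (first w, rest w)) (fun p => Word p.1 p.2).
Proof. by case. Qed.

HB.instance Definition _ (X : choiceType) :=
  Choice.copy (word X) (can_type (@word_pairK X)).

Fact word_catA X : associative (@word_cat X).
Proof. by move=> [x r] [y s] [z t]; rewrite /word_cat /letters /= -catA. Qed.

HB.instance Definition _ (X : choiceType) :=
  isSemigroup.Build (word X) (@word_catA X).

Record presentation := Presentation {
  gen : choiceType;
  relator : word gen -> word gen -> Prop
}.

Inductive congruence (P : presentation) : word (gen P) -> word (gen P) -> Prop :=
| congr_relator u v : relator u v -> congruence u v
| congr_refl u : congruence u u
| congr_sym u v : congruence u v -> congruence v u
| congr_trans v u w : congruence u v -> congruence v w -> congruence u w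
| congr_mul u u' v v' :
    congruence u u' -> congruence v v' -> congruence (u * v) (u' * v').

Section Presented.
Variable P : presentation.

Definition congruenceb (u v : word (gen P)) : bool := `[<congruence u v>].

Fact congruenceb_equiv : equiv_class_of congruenceb.
Proof.
split=> [u|u v|v u w].
- exact/asboolP/congr_refl.
- by apply/asboolP/asboolP; apply: congr_sym.
- by move=> /asboolP uv /asboolP vw; apply/asboolP/(congr_trans uv).
Qed.

Definition congruence_rel := EquivRelPack congruenceb_equiv.

Definition presented : Type := {eq_quot congruence_rel}.

HB.instance Definition _ := Choice.on presented.
HB.instance Definition _ := EqQuotient.on presented.

Definition presented_mul (a b : presented) : presented :=
  \pi_presented (repr a * repr b).

Lemma pi_presentedP u v :
  (\pi_presented u = \pi_presented v) <-> congruence u v.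
Proof. by split=> [/eqmodP/asboolP|uv]; [|apply/eqmodP/asboolP]. Qed.

Lemma repr_pi_presented u : congruence (repr (\pi_presented u)) u.
Proof. by apply/pi_presentedP; rewrite reprK. Qed.

Fact presented_mulA : associative presented_mul.
Proof.
move=> a b c; apply/pi_presentedP; apply: (@congr_trans _ (repr a * repr b * repr c)).
  rewrite -mulgA; apply: congr_mul; [exact: congr_refl|exact: repr_pi_presented].
apply: congr_mul; [exact/congr_sym/repr_pi_presented|exact: congr_refl].
Qed.

HB.instance Definition _ := isSemigroup.Build presented presented_mulA.

Definition pi_presented (u : word (gen P)) : presented := \pi_presented u.

Fact pi_presented_gmulfM : {morph pi_presented : u v / u * v}.
Proof.
move=> u v; apply/pi_presentedP/congr_sym.
by apply: congr_mul; apply: repr_pi_presented.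
Qed.

HB.instance Definition _ :=
  isMultiplicative.Build _ _ pi_presented pi_presented_gmulfM.

End Presented.

Inductive sum_relator (P1 P2 : presentation) :
    word (gen P1 + gen P2) -> word (gen P1 + gen P2) -> Prop :=
| sum_relator_l u v :
    relator u v -> sum_relator (map_word inl u) (map_word inl v)
| sum_relator_r u v :
    relator u v -> sum_relator (map_word inr u) (map_word inr v).

(* < X1 |_| X2 | R1 |_| R2 > *)
Definition sum_presentation (P1 P2 : presentation) : presentation :=
  Presentation (@sum_relator P1 P2).

Inductive table_relator (S : semigroupType) : word S -> word S -> Prop :=
| Table_relator x y : table_relator (letter x * letter y) (letter (x * y)).

(* The multiplication table presentation < S | x . y = xy >. *)
Definition table_presentation (S : semigroupType) : presentation :=
  Presentation (@table_relator S).

(* The choice of the presentations of S and T is irrelevant up to isomorphism,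
   see [presented_sum] and the universal property [free_product_coproduct]. *)
Definition free_product (S T : semigroupType) : semigroupType :=
  presented (sum_presentation (table_presentation S) (table_presentation T)).

Section WordEval.
Variables (X : choiceType) (U : semigroupType) (f : X -> U).

Definition word_eval (w : word X) : U :=
  foldl (fun a x => a * f x) (f (first w)) (rest w).

Fact word_eval_gmulfM : {morph word_eval : u v / u * v}.
Proof.
move=> [x r] [y s]; rewrite /word_eval /= foldl_cat /=.
elim/last_ind: s => [//|s z IH].
by rewrite -!cats1 !foldl_cat /= IH mulgA.
Qed.

HB.instance Definition _ :=
  isMultiplicative.Build _ _ word_eval word_eval_gmulfM.

End WordEval.

Lemma multiplicative_word_eval (X : choiceType) (U : semigroupType)
    (h : {multiplicative word X -> U}) (w : word X) :
  h w = word_eval (fun x => h (letter x)) w.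
Proof.
case: w => x s; elim/last_ind: s => [//|s y IH].
have -> : Word x (rcons s y) = Word x s * letter y by rewrite -cats1.
by rewrite gmulfM IH gmulfM.
Qed.

Lemma eq_word_eval (X : choiceType) (U : semigroupType) (f g : X -> U) :
  f =1 g -> word_eval f =1 word_eval g.
Proof. by move=> /funext ->. Qed.

Lemma word_eval_map (X Y : choiceType) (U : semigroupType) (i : X -> Y)
    (f : Y -> U) (w : word X) :
  word_eval f (map_word i w) = word_eval (fun x => f (i x)) w.
Proof.
case: w => x s; rewrite /word_eval /=.
by elim: s (f (i x)) => [//|y s IH] a /=; rewrite IH.
Qed.

Lemma multiplicative_comp (S T U : semigroupType)
    (f : {multiplicative S -> T}) (g : {multiplicative T -> U}) :
  exists h : {multiplicative S -> U}, h =1 g \o f.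
Proof.
have gfM : {morph g \o f : x y / x * y} by move=> x y /=; rewrite !gmulfM.
by exists (HB.pack_for {multiplicative S -> U} (g \o f)
  (isMultiplicative.Build S U (g \o f) gfM)).
Qed.

Lemma bijective_multiplicative (S T : semigroupType)
    (f : {multiplicative S -> T}) : bijective f ->
  exists2 g : {multiplicative T -> S}, cancel f g & cancel g f.
Proof.
move=> [g fK gK]; have gM : {morph g : x y / x * y}.
  by move=> x y; apply: (can_inj fK); rewrite gmulfM !gK.
by exists (HB.pack_for {multiplicative T -> S} g
  (isMultiplicative.Build T S g gM)).
Qed.

Lemma presented_lift (P : presentation) (U : semigroupType) (f : gen P -> U) :
  (forall u v, relator u v -> word_eval f u = word_eval f v) ->
  exists h : {multiplicative presented P -> U},
    forall w, h (pi_presented w) = word_eval f w.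
Proof.
move=> fR; have fC u v : congruence u v -> word_eval f u = word_eval f v.
  elim=> {u v} [u v /fR//|//|u v _ -> //|v u w _ -> _ -> //|u u' v v' _ uu _ vv].
  by rewrite !word_eval_gmulfM uu vv.
pose h (a : presented P) := word_eval f (repr a).
have hpi w : h (pi_presented w) = word_eval f w.
  exact/fC/repr_pi_presented.
have hM : {morph h : a b / a * b}.
  by move=> a b; rewrite -[a]reprK -[b]reprK -pi_presented_gmulfM !hpi word_eval_gmulfM.
by exists (HB.pack_for {multiplicative presented P -> U} h
  (isMultiplicative.Build _ _ h hM)).
Qed.

Lemma presented_ext (P : presentation) (U : semigroupType)
    (h h' : {multiplicative presented P -> U}) :
  (forall x, h (pi_presented (letter x)) = h' (pi_presented (letter x))) ->
  h =1 h'.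
Proof.
move=> hh a; rewrite -[a]reprK; set w := repr a.
have [k kE] := multiplicative_comp (pi_presented (P:=P)) h.
have [k' kE'] := multiplicative_comp (pi_presented (P:=P)) h'.
have := multiplicative_word_eval k w; rewrite kE /= => ->.
have := multiplicative_word_eval k' w; rewrite kE' /= => ->.
by apply: eq_word_eval => x; rewrite kE kE' /= hh.
Qed.

Definition coproduct (S T C : semigroupType)
    (i : {multiplicative S -> C}) (j : {multiplicative T -> C}) : Prop :=
  forall (U : semigroupType)
    (f : {multiplicative S -> U}) (g : {multiplicative T -> U}),
  exists h : {multiplicative C -> U},
    [/\ h \o i =1 f, h \o j =1 g &
        forall h' : {multiplicative C -> U},
          h' \o i =1 f -> h' \o j =1 g -> h' =1 h].

Lemma presented_table (S : semigroupType) :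
  exists2 i : {multiplicative S -> presented (table_presentation S)},
    forall x, i x = pi_presented (P:=table_presentation S) (letter x) & bijective i.
Proof.
pose P := table_presentation S.
pose i (x : S) : presented P := pi_presented (P:=P) (letter x).
have iM : {morph i : x y / x * y}.
  move=> x y; rewrite -[RHS]pi_presented_gmulfM.
  exact/pi_presentedP/congr_sym/congr_relator/Table_relator.
exists (HB.pack_for {multiplicative S -> presented P} i
  (isMultiplicative.Build _ _ i iM)) => //.
have [|h hE] := @presented_lift P S id; first by move=> _ _ [x y].
have sur (a : presented P) : exists x, a = i x.
  rewrite -[a]reprK; case: (repr a) => x s.
  elim/last_ind: s => [|s y [z zE]]; first by exists x.
  exists (z * y); rewrite iM -zE -[RHS]pi_presented_gmulfM; congr pi_presented.
  by rewrite -cats1.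
have hi x : h (i x) = x by exact: (hE (letter x)).
by exists h => [x|a] /=; [exact: hi|have [x ->] := sur a; rewrite hi].
Qed.

Lemma presented_sum_coproduct (P1 P2 : presentation) :
  exists (i : {multiplicative presented P1 -> presented (sum_presentation P1 P2)})
         (j : {multiplicative presented P2 -> presented (sum_presentation P1 P2)}),
    [/\ forall x, i (pi_presented (letter x)) =
          pi_presented (P:=sum_presentation P1 P2) (letter (inl x)),
        forall x, j (pi_presented (letter x)) =
          pi_presented (P:=sum_presentation P1 P2) (letter (inr x)) &
        coproduct i j].
Proof.
set P := sum_presentation P1 P2.
pose l (z : gen P) : presented P := pi_presented (letter z).
have lE w : word_eval l w = pi_presented w.
  by rewrite [RHS]multiplicative_word_eval.
have [|i iE] := @presented_lift P1 (presented P) (fun x => l (inl x)).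
  move=> u v uv; rewrite -!(word_eval_map (inl : _ -> gen P)) !lE.
  exact/pi_presentedP/congr_relator/sum_relator_l.
have [|j jE] := @presented_lift P2 (presented P) (fun x => l (inr x)).
  move=> u v uv; rewrite -!(word_eval_map (inr : _ -> gen P)) !lE.
  exact/pi_presentedP/congr_relator/sum_relator_r.
exists i, j; split=> [x|x|U f g]; [by rewrite iE|by rewrite jE|].
pose k (z : gen P) : U := match z with
  | inl x => f (pi_presented (letter x))
  | inr x => g (pi_presented (letter x)) end.
have kl w : word_eval (fun x => k (inl x)) w = f (pi_presented w).
  have [f' f'E] := multiplicative_comp (pi_presented (P:=P1)) f.
  have /= <- := f'E w; rewrite [RHS]multiplicative_word_eval.
  by apply: eq_word_eval => x; rewrite f'E.
have kr w : word_eval (fun x => k (inr x)) w = g (pi_presented w).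
  have [g' g'E] := multiplicative_comp (pi_presented (P:=P2)) g.
  have /= <- := g'E w; rewrite [RHS]multiplicative_word_eval.
  by apply: eq_word_eval => x; rewrite g'E.
have [|h hE] := @presented_lift P U k.
  move=> _ _ [] u v uv; rewrite !word_eval_map ?kl ?kr; congr (_ _);
  exact/pi_presentedP/congr_relator.
exists h; split.
- have [hi hiE] := multiplicative_comp i h.
  move=> a; rewrite -hiE; move: a; apply: presented_ext => x.
  by rewrite hiE /= iE hE.
- have [hj hjE] := multiplicative_comp j h.
  move=> a; rewrite -hjE; move: a; apply: presented_ext => x.
  by rewrite hjE /= jE hE.
move=> h' h'i h'j; apply: presented_ext => -[] x; rewrite hE /word_eval /=.
- by have /= <- := h'i (pi_presented (letter x)); rewrite iE.
- by have /= <- := h'j (pi_presented (letter x)); rewrite jE.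
Qed.

Lemma coproduct_unique (S T C C' : semigroupType)
    (i : {multiplicative S -> C}) (j : {multiplicative T -> C})
    (i' : {multiplicative S -> C'}) (j' : {multiplicative T -> C'}) :
  coproduct i j -> coproduct i' j' -> isomorphic C C'.
Proof.
move=> cC cC'.
have [h [hi hj _]] := cC C' i' j'; have [h' [hi' hj' _]] := cC' C i j.
have self (D : semigroupType) (p : {multiplicative S -> D}) (q : {multiplicative T -> D})
    (k : {multiplicative D -> D}) :
    coproduct p q -> k \o p =1 p -> k \o q =1 q -> k =1 id.
  move=> cD kp kq; have [e [_ _ eU]] := cD D p q.
  have idM : {morph @id D : x y / x * y} by [].
  pose I := HB.pack_for {multiplicative D -> D} (@id D)
    (isMultiplicative.Build D D (@id D) idM).
  by move=> x; rewrite (eU k) // -(eU I).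
have [k kE] := multiplicative_comp h h'.
have [k' kE'] := multiplicative_comp h' h.
exists h; exists h' => x.
- rewrite -[LHS]kE; apply: (self _ i j) => // y.
  + by rewrite /= kE /=; have /= -> := hi y; have /= -> := hi' y.
  + by rewrite /= kE /=; have /= -> := hj y; have /= -> := hj' y.
- rewrite -[LHS]kE'; apply: (self _ i' j') => // y.
  + by rewrite /= kE' /=; have /= -> := hi' y; have /= -> := hi y.
  + by rewrite /= kE' /=; have /= -> := hj' y; have /= -> := hj y.
Qed.

Lemma coproduct_isomorphic (S T S' T' C : semigroupType)
    (i : {multiplicative S -> C}) (j : {multiplicative T -> C}) :
  coproduct i j ->
  forall (a : {multiplicative S' -> S}) (b : {multiplicative T' -> T})
    (i' : {multiplicative S' -> C}) (j' : {multiplicative T' -> C}),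
  bijective a -> bijective b -> i' =1 i \o a -> j' =1 j \o b ->
  coproduct i' j'.
Proof.
move=> cC a b i' j' ba bb i'E j'E U f g.
have [a' aK a'K] := bijective_multiplicative ba.
have [b' bK b'K] := bijective_multiplicative bb.
have [f' f'E] := multiplicative_comp a' f.
have [g' g'E] := multiplicative_comp b' g.
have [h [hi hj hU]] := cC U f' g'.
exists h; split=> [x|x|h' h'i h'j].
- by rewrite /= i'E /=; have /= -> := hi (a x); rewrite f'E /= aK.
- by rewrite /= j'E /=; have /= -> := hj (b x); rewrite g'E /= bK.
apply: hU => x /=.
- by rewrite f'E /= -h'i /= i'E /= a'K.
- by rewrite g'E /= -h'j /= j'E /= b'K.
Qed.

Lemma free_product_coproduct (S T : semigroupType) :
  exists (i : {multiplicative S -> free_product S T})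
         (j : {multiplicative T -> free_product S T}),
    [/\ forall x, i x = pi_presented
            (P:=sum_presentation (table_presentation S) (table_presentation T))
            (letter (inl x)),
        forall y, j y = pi_presented
            (P:=sum_presentation (table_presentation S) (table_presentation T))
            (letter (inr y)) & coproduct i j].
Proof.
have [a aE ba] := presented_table S; have [b bE bb] := presented_table T.
have [i [j [iE jE cC]]] :=
  presented_sum_coproduct (table_presentation S) (table_presentation T).
have [i' i'E] := multiplicative_comp a i; have [j' j'E] := multiplicative_comp b j.
exists i', j'; split=> [x|y|]; [by rewrite i'E /= aE iE|by rewrite j'E /= bE jE|].
exact: (coproduct_isomorphic cC ba bb).
Qed.

Lemma presented_sum (P1 P2 : presentation) (S T : semigroupType) :
  isomorphic (presented P1) S -> isomorphic (presented P2) T ->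
  isomorphic (presented (sum_presentation P1 P2)) (free_product S T).
Proof.
move=> [a ba] [b bb].
have [i [j [_ _ cC]]] := free_product_coproduct S T.
have [i0 [j0 [_ _ cC0]]] := presented_sum_coproduct P1 P2.
have [i' i'E] := multiplicative_comp a i; have [j' j'E] := multiplicative_comp b j.
exact/(coproduct_unique cC0)/(coproduct_isomorphic cC ba bb).
Qed.

(* The symbols acted upon are written from left to right, and maps act on the
   right: in state q, reading a, the automaton moves to state (trans (q, a)).1
   and outputs (trans (q, a)).2. *)
Record automaton := Automaton {
  state : finType;
  symbol : finType;
  trans : state * symbol -> state * symbol
}.

Fixpoint act (A : automaton) (q : state A) (alpha : seq (symbol A)) :
    seq (symbol A) :=
  if alpha is a :: alpha' then
    let: (q', b) := trans (q, a) in b :: act q' alpha'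
  else [::].

Definition act_word (A : automaton) (w : word (state A))
    (alpha : seq (symbol A)) : seq (symbol A) :=
  foldl (fun beta q => act q beta) alpha (letters w).

(* Endomorphisms of the rooted tree B^*: the root is fixed, and children are
   mapped to children. *)
Record tree_end (B : Type) := TreeEnd {
  tree_map :> seq B -> seq B;
  tree_map_root : tree_map [::] = [::];
  tree_map_child : forall alpha b, exists c,
    tree_map (rcons alpha b) = rcons (tree_map alpha) c
}.

Lemma tree_end_eq B (f g : tree_end B) : f =1 g -> f = g.
Proof.
case: f g => [f f0 fS] [g g0 gS] /= /funext fg; subst g.
by rewrite (Prop_irrelevance f0 g0) (Prop_irrelevance fS gS).
Qed.

HB.instance Definition _ B := gen_eqMixin (tree_end B).
HB.instance Definition _ B := gen_choiceMixin (tree_end B).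

Section TreeEndSemigroup.
Variable B : Type.
Implicit Types f g h : tree_end B.

Fact tree_end_mul_root f g : g (f [::]) = [::].
Proof. by rewrite !tree_map_root. Qed.

Fact tree_end_mul_child f g alpha b :
  exists c, g (f (rcons alpha b)) = rcons (g (f alpha)) c.
Proof.
by have [c ->] := tree_map_child f alpha b; apply: tree_map_child.
Qed.

(* Maps are written on the right: f * g is f followed by g. *)
Definition tree_end_mul f g : tree_end B :=
  @TreeEnd _ (fun alpha => g (f alpha))
    (tree_end_mul_root f g) (tree_end_mul_child f g).

Fact tree_end_mulA : associative tree_end_mul.
Proof. by move=> f g h; apply: tree_end_eq. Qed.

HB.instance Definition _ := isSemigroup.Build (tree_end B) tree_end_mulA.

End TreeEndSemigroup.

Section AutomatonSemigroup.
Variable A : automaton.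

Lemma act_child (q : state A) alpha b :
  exists c, act q (rcons alpha b) = rcons (act q alpha) c.
Proof.
elim: alpha q => [|a alpha IH] q /=.
  by case: (trans (q, b)) => q' c; exists c.
by case: (trans (q, a)) => q' a'; have [c ->] := IH q'; exists c.
Qed.

Fact act_word_root (w : word (state A)) : act_word w [::] = [::].
Proof. by rewrite /act_word; elim: (letters w). Qed.

Fact act_word_child (w : word (state A)) alpha b :
  exists c, act_word w (rcons alpha b) = rcons (act_word w alpha) c.
Proof.
rewrite /act_word; elim: (letters w) alpha b => [|q s IH] alpha b /=.
  by exists b.
by have [c ->] := act_child q alpha b; apply: IH.
Qed.

Definition phi (w : word (state A)) : tree_end (symbol A) :=
  TreeEnd (act_word_root w) (act_word_child w).

Fact phi_gmulfM : {morph phi : u v / u * v}.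
Proof.
by move=> u v; apply: tree_end_eq => alpha; rewrite /= /act_word -foldl_cat.
Qed.

HB.instance Definition _ := isMultiplicative.Build _ _ phi phi_gmulfM.

Definition in_Sigma : pred (tree_end (symbol A)) :=
  fun f => `[<exists w, f = phi w>].

Record Sigma := SigmaElt { Sigma_val : tree_end (symbol A); _ : in_Sigma Sigma_val }.

HB.instance Definition _ := [isSub for Sigma_val].
HB.instance Definition _ := [Choice of Sigma by <:].

Fact in_Sigma_mul : mulg_closed in_Sigma.
Proof.
move=> f g /asboolP[u ->] /asboolP[v ->].
by apply/asboolP; exists (u * v); rewrite gmulfM.
Qed.

HB.instance Definition _ :=
  SubChoice_isSubSemigroup.Build _ in_Sigma Sigma in_Sigma_mul.

End AutomatonSemigroup.

Definition automaton_semigroup (S : semigroupType) : Prop :=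
  exists A : automaton, isomorphic S (Sigma A).

(* Main.v *)
Require Import Defs.
From HB Require Import structures.
From mathcomp Require Import all_boot generic_quotient boolp.

Set Implicit Arguments.
Unset Strict Implicit.
Unset Printing Implicit Defensive.

Import Algebra.

Local Open Scope group_scope.

(** Letters of S and T act on a finite alphabet in such a way that one input
    symbol, [start], reveals the first two syllables of an alternating word and
    leaves a shorter alternating word for the remaining input.

    Let x1 x2 x3 ... xn be an alternating product of elements of S and of T.
    The symbol [start] travels through the word from left to right, collecting
    x1 and x2 on its way, and the output symbol shows both of them.  No state
    acts as the identity, so the syllables already read cannot be erased; but
    they can be overwritten by one and the same idempotent f, taken from the
    factor to which x2 belongs.  The word left behind is f f x3 ... xn, which
    in the free product is f x3 ... xn: alternating again, and one syllable
    shorter.  Hence two alternating words with the same action agree in their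
    first two syllables and, by induction on the length, in all others
    ([acts_inj]).  The idempotents exist because S and T are finite
    ([idempotent_exists]); that they are idempotent is also what makes the
    action respect the multiplication tables of S and T ([act_fuse]), so that
    the states x, y and xy satisfy the same relation as in the free product.

    Every word is congruent to an alternating one ([alternating_form]), so the
    action identifies exactly the congruent words, and the free product is the
    semigroup generated by the states ([presented_automaton]). *)

(** * Automaton semigroups from presentations *)

Lemma presented_automaton (A : automaton)
    (R : word (state A) -> word (state A) -> Prop) :
    (forall u v, congruence (P := Presentation R) u v <-> phi u = phi v) ->
  automaton_semigroup (presented (Presentation R)).
Proof.
move=> congrE; exists A.
have SigmaP (w : word (state A)) : in_Sigma (phi w) by apply/asboolP; exists w.
pose toSigma w : Sigma A := SigmaElt (SigmaP w).
have toSigmaM : {morph toSigma : u v / u * v}.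
  by move=> u v; apply: val_inj; rewrite gmulfM /= phi_gmulfM.
have toSigmaE w : word_eval (fun x => toSigma (letter x)) w = toSigma w.
  pose f := HB.pack_for {multiplicative word (state A) -> Sigma A} toSigma
    (isMultiplicative.Build _ _ toSigma toSigmaM).
  by rewrite -(multiplicative_word_eval f).
have [|h hE] := @presented_lift (Presentation R) (Sigma A)
                   (fun x => toSigma (letter x)).
  by move=> u v /congr_relator/congrE uv; rewrite !toSigmaE; apply: val_inj.
exists h.
have wordP (f : Sigma A) : exists w, val f = phi w.
  by case: f => f /= /asboolP.
exists (fun f => pi_presented (P := Presentation R) (sval (cid (wordP f)))).
- move=> a; rewrite -[a]reprK; apply/pi_presentedP/congrE.
  by case: (cid _) => w /= <-; rewrite hE toSigmaE.
- move=> f; rewrite hE toSigmaE; apply: val_inj.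
  by case: (cid _) => w /= ->.
Qed.

(** * Idempotents of finite semigroups *)

(** Among the powers of s two coincide, so from some exponent i on they are
    periodic with some period p.  A power whose exponent is a multiple of p and
    at least i does not change when this exponent is doubled. *)
Lemma idempotent_exists (S : finSemigroupType) (s : S) :
  exists e : S, e * e = e.
Proof.
(* The exponents are shifted by one: pw k is the (k + 1)-st power. *)
pose pw k := iter k (fun x => s * x) s.
have pwD k l : pw k * pw l = pw (k + l).+1.
  by elim: k => [//|k IH]; rewrite -[LHS]/(s * pw k * pw l) -mulgA IH.
have [i [p p_gt0 pwi]] : exists i, exists2 p, 0 < p & pw (i + p) = pw i.
  have /injectivePn[i [j neq_ij eq_pw]] :
      ~~ injectiveb (fun k : 'I_#|S|.+1 => pw k).
    by apply/injectiveP => /leq_card; rewrite card_ord ltnn.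
  wlog lt_ij : i j neq_ij eq_pw / i < j.
    move=> H; case: (ltngtP i j) => [lt_ij|lt_ji|/val_inj ij].
    - exact: (H i j).
    - by apply: (H j i) => //; rewrite eq_sym.
    - by rewrite ij eqxx in neq_ij.
  by exists i, (j - i)%N; rewrite ?subn_gt0 // subnKC // ltnW.
have period k m : i <= k -> pw (k + m * p) = pw k.
  move=> le_ik; have step l : i <= l -> pw (l + p) = pw l.
    move=> le_il; rewrite -(subnK le_il) -addnA.
    by elim: (l - i)%N => [//|d IH]; rewrite !addSn /= IH.
  elim: m => [|m IH]; first by rewrite mul0n addn0.
  by rewrite mulSnr addnA step ?IH // (leq_trans le_ik) ?leq_addr.
have np_gt0 : 0 < i.+1 * p by rewrite muln_gt0.
exists (pw (i.+1 * p).-1); rewrite pwD -addnS prednK // period //.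
by rewrite -ltnS prednK // leq_pmulr.
Qed.

Definition idempotent (S : finSemigroupType) (s : S) : S :=
  odflt s [pick e : S | e * e == e].

Lemma idempotentP (S : finSemigroupType) (s : S) :
  idempotent s * idempotent s = idempotent s.
Proof.
rewrite /idempotent; case: pickP => [e /eqP //|no_idem].
by have [e /eqP] := idempotent_exists s; rewrite no_idem.
Qed.

Lemma idempotent_const (S : finSemigroupType) (s s' : S) :
  idempotent s = idempotent s'.
Proof.
rewrite /idempotent; case: pickP => [//|no_idem].
by have [e /eqP] := idempotent_exists s; rewrite no_idem.
Qed.

(** * The automaton of a free product *)

Section FreeProduct.
Variables S T : finSemigroupType.
Implicit Types (x y z a c : S + T) (r s t : seq (S + T)).

Definition fuse x y : option (S + T) :=
  match x, y with
  | inl p, inl q => Some (inl (p * q))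
  | inr p, inr q => Some (inr (p * q))
  | _, _ => None
  end.

Definition alternate x y : bool := ~~ fuse x y.

Lemma fuseA x y z : obind (fuse x) (fuse y z) = obind (fuse^~ z) (fuse x y).
Proof. by case: x y z => [p|p] [q|q] [r|r] //=; rewrite mulgA. Qed.

Lemma fuse_alternate x y z a :
  fuse x y = Some z -> alternate y a = alternate z a.
Proof. by case: x y => [p|p] [q|q] // [<-]; case: a. Qed.

(** What overwrites the syllable of x and the one after it, which belongs to the
    other factor.  If that factor is empty, the idempotent is taken from the
    factor of x: no second syllable will ever follow, but x still needs to leave
    behind a letter, in a way that respects products. *)
Definition filler x : S + T :=
  match x with
  | inl p =>
      if [pick q : T | true] is Some q then inr (idempotent q)
      else inl (idempotent p)
  | inr q =>
      if [pick p : S | true] is Some p then inl (idempotent p)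
      else inr (idempotent q)
  end.

Lemma filler_idempotent x : fuse (filler x) (filler x) = Some (filler x).
Proof.
by case: x => p /=; case: pickP => [q _|_] /=; rewrite idempotentP.
Qed.

Lemma filler_fuse x y z : fuse x y = Some z -> filler z = filler x.
Proof.
case: x y => [p|p] [q|q] // [<-] /=; case: pickP => // _;
by rewrite (idempotent_const (p * q) p).
Qed.

Lemma filler_alternate x c z :
  alternate x c -> alternate (filler x) z = alternate c z.
Proof.
case: x c => [p|p] [q|q] // _ /=.
all: by case: pickP => [r _|/(_ q)] //; case: z.
Qed.

(** What a symbol remembers of the word that it has passed through.  The boolean
    says whether a third syllable has begun: later letters from the factor of
    the second syllable must then not be taken for a part of it. *)
Definition memory : finType := option ((S + T) * option ((S + T) * bool)).

Definition start : memory := None.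
Definition one_syllable x : memory := Some (x, None).
Definition two_syllables x c more : memory := Some (x, Some (c, more)).

(** A letter of the first syllable has to be overwritten before the second
    syllable is seen.  This is possible because the letter already determines
    the factor of the second syllable, and hence the idempotent used for both. *)
Definition step (q : (S + T) * memory) : (S + T) * memory :=
  let: (x, b) := q in
  match b with
  | None => (filler x, one_syllable x)
  | Some (a, None) =>
      (filler a, if fuse a x is Some c then one_syllable c
                 else two_syllables a x false)
  | Some (a, Some (c, false)) =>
      if fuse c x is Some d then (filler a, two_syllables a d false)
      else (x, two_syllables a c true)
  | Some (a, Some (c, true)) => (x, two_syllables a c true)
  end.

Definition free_product_automaton : automaton := Automaton step.

Local Notation phi := (@phi free_product_automaton).
Local Notation act := (@act free_product_automaton).
Local Notation acts s alpha := (foldl (fun beta q => act q beta) alpha s).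

Lemma act_cons x b alpha :
  act x (b :: alpha) = (step (x, b)).2 :: act (step (x, b)).1 alpha.
Proof.
by rewrite -[LHS]/(let: (y, c) := step (x, b) in c :: act y alpha); case: step.
Qed.

(** Why the action respects the multiplication tables, for one input symbol: the
    syllables that it collects are multiplied associatively, the product of two
    overwritten letters is again the idempotent that overwrites each of them,
    and from the third syllable on the letters do not change. *)
Lemma step_fuse x y z b (x' := step (x, b)) (y' := step (y, x'.2))
    (z' := step (z, b)) :
  fuse x y = Some z -> fuse x'.1 y'.1 = Some z'.1 /\ y'.2 = z'.2.
Proof.
rewrite {}/y' {}/x' {}/z' => xy.
case: b => [[a [[c [|]]|]]|] //=.
- have := fuseA c x y; rewrite xy /=.
  case cx: (fuse c x) => [d|] /= -> //.
  case dy: (fuse d y) => [e|] /=; first by rewrite filler_idempotent.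
  by have := fuse_alternate y cx; rewrite /alternate xy dy.
- have := fuseA a x y; rewrite xy /=.
  case ax: (fuse a x) => [d|] /= ->; last by rewrite xy filler_idempotent.
  case dy: (fuse d y) => [e|].
    by rewrite (filler_fuse ax) filler_idempotent.
  by have := fuse_alternate y ax; rewrite /alternate xy dy.
- by rewrite xy filler_idempotent (filler_fuse xy).
Qed.

Lemma act_fuse x y z alpha :
  fuse x y = Some z -> act y (act x alpha) = act z alpha.
Proof.
elim: alpha x y z => [//|b alpha IH] x y z xy; rewrite !act_cons.
by have [/IH -> ->] := step_fuse b xy.
Qed.

(** * Alternating words *)

Lemma acts_more a c s alpha :
  acts s (two_syllables a c true :: alpha) =
    two_syllables a c true :: acts s alpha.
Proof. by elim: s alpha => //= x s IH alpha; rewrite IH. Qed.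

(** The word left behind begins with [filler x] twice, once for each of the
    syllables x and c; the two copies fuse into one, which makes the word one
    syllable shorter while it stays alternating. *)
Lemma acts_start x c s alpha :
    path alternate x (c :: s) ->
  acts (x :: c :: s) (start :: alpha) =
    two_syllables x c (s != [::]) :: acts (filler x :: s) alpha.
Proof.
rewrite /= {1}/alternate; case xc: (fuse x c) => [//|] /= alt_s.
rewrite (act_fuse _ (filler_idempotent x)).
case: s alt_s => [//|z s] /=; rewrite {1}/alternate.
by case: (fuse c z) => [//|] _; rewrite /= acts_more.
Qed.

(** By induction on the number of syllables: the output for [start] shows the
    first two of them, or that there is only one, and what the word does to the
    rest of the input is the action of a shorter alternating word that contains
    all the other syllables. *)
Lemma acts_inj x y s t :
    path alternate x s -> path alternate y t ->
    (forall alpha, acts (x :: s) alpha = acts (y :: t) alpha) ->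
  x = y /\ s = t.
Proof.
elim: s x y t => [|c s IH] x y [|d t] alt_s alt_t eq_act.
- by have [->] := eq_act [:: start].
- by have := eq_act [:: start]; rewrite (acts_start _ alt_t).
- by have := eq_act [:: start]; rewrite (acts_start _ alt_s).
have eq_start alpha := eq_act (start :: alpha).
have [xy cd] : x = y /\ c = d.
  by have := eq_start [::]; rewrite !acts_start // => -[-> ->].
subst y d; split=> //; congr (_ :: _).
have alt_filler r : path alternate x (c :: r) -> path alternate (filler x) r.
  by case: r => [//|z r] /= /andP[xc]; rewrite (filler_alternate _ xc).
have [//|//|//|_ //] := IH (filler x) (filler x) t.
- exact: alt_filler.
- exact: alt_filler.
- by move=> alpha; have := eq_start alpha; rewrite !acts_start // => -[].
Qed.

Local Notation P :=
  (sum_presentation (table_presentation S) (table_presentation T)).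

Lemma congruence_fuse x y z :
  fuse x y = Some z ->
  congruence (P := P) (letter x * letter y) (letter z).
Proof.
case: x y => [p|p] [q|q] // [<-]; apply: congr_relator.
- exact: (@sum_relator_l (table_presentation S) (table_presentation T)
            _ _ (Table_relator p q)).
- exact: (@sum_relator_r (table_presentation S) (table_presentation T)
            _ _ (Table_relator p q)).
Qed.

(** Adding a letter in front of an alternating word creates at most one adjacent
    pair from the same factor, and fusing it does not affect the factor of the
    first letter. *)
Lemma alternating_form (w : word (gen P)) :
  exists2 w', congruence w w' & path alternate (first w') (rest w').
Proof.
case: w => x s; elim: s x => [|y s IH] x.
  by exists (letter x) => //; apply: congr_refl.
have [[y' s'] /= ys alt_s'] := IH y.
have xys : congruence (P := P) (Word x (y :: s)) (letter x * Word y' s').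
  exact: congr_mul (congr_refl (P := P) (letter x)) ys.
case xy: (fuse x y') => [z|]; last first.
  by exists (Word x (y' :: s')) => //=; rewrite /alternate xy.
exists (Word z s') => /=; last first.
  by case: s' alt_s' {ys xys} => //= h s'; rewrite (fuse_alternate _ xy).
apply: congr_trans xys _; case: s' {ys alt_s'} => [|h s'].
  exact: congruence_fuse.
exact: congr_mul (congruence_fuse xy) (congr_refl (P := P) (Word h s')).
Qed.

(** Soundness comes down to the relators, which are instances of [act_fuse];
    for the converse, u and v are replaced by alternating words. *)
Lemma congruence_phi (u v : word (gen P)) :
  congruence u v <-> phi u = phi v.
Proof.
have sound (w w' : word (gen P)) :
    congruence w w' -> phi w = phi w'.
  elim=> {w w'} //.
  - move=> _ _ [] _ _ [p q]; apply: tree_end_eq => alpha;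
    exact: act_fuse.
  - by move=> w' w w'' _ -> _ ->.
  - by move=> w w' z z' _ ww' _ zz'; rewrite !phi_gmulfM ww' zz'.
split=> [|uv]; first exact: sound.
have [[x s] /= ux alt_s] := alternating_form u.
have [[y t] /= vy alt_t] := alternating_form v.
have [alpha|xy st] := acts_inj alt_s alt_t.
  have eq_phi : phi (Word x s) = phi (Word y t).
    by rewrite -(sound _ _ ux) -(sound _ _ vy).
  exact: (congr1 (fun f : tree_end memory => f alpha) eq_phi).
by subst y t; apply: (congr_trans ux); apply: congr_sym.
Qed.

End FreeProduct.

Theorem theorem2 (S T : finSemigroupType) :
  automaton_semigroup (free_product S T).
Proof.
exact: (presented_automaton (A := free_product_automaton S T)
          (@congruence_phi S T)).
Qed.
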